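(* Let $n,t\in\mathbb N$ with $t\le n-1$. Let $\mathcal F(n,t)$ be the class of forests on vertex set $[n]$ consisting of exactly $t$ trees such that the vertices $1,\dots,t$ lie in pairwise different trees, let $F$ be chosen uniformly at random from $\mathcal F(n,t)$, and let $(d_F(1),\dots,d_F(n))$ be its degree sequence. Throw $n-t-1$ balls independently and uniformly at random into $n$ bins $B_1,\dots,B_n$ and let $L_j$ be the number of balls in $B_j$. Independently, let $R$ be uniform on $[t]$ and for $j\in[t]$ let $I_j=1$ if $R=j$ and $I_j=0$ otherwise. Then $$(L_1+I_1,\dots,L_t+I_t,\,L_{t+1}+1,\dots,L_n+1)$$ has the same distribution as $(d_F(1),\dots,d_F(n))$.
   Context: $[n]=\{1,\dots,n\}$; $d_F(v)$ is the degree of vertex $v$ in $F$. *)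

(* Defs.v *)
From mathcomp Require Import all_boot all_order all_algebra.

Set Implicit Arguments.
Unset Strict Implicit.
Unset Printing Implicit Defensive.

Import GRing.Theory.

(* A graph on V is given by its set of edges, each edge being a set of
   vertices; it is simple when all edges have exactly two ends. *)
Section Graphs.

Variable V : finType.
Implicit Types (E : {set {set V}}) (x y v : V).

Definition simple_graph E : bool := [forall e in E, #|e| == 2].

(* In a simple graph this relation is irreflexive since [set x; x] is a
   singleton. *)
Definition adj E : rel V := fun x y => [set x; y] \in E.

Definition degree E v : nat := #|[set y | adj E v y]|.

(* A cycle has pairwise distinct vertices, so at most #|V| of them; acyclicP
   below removes this bound. *)
Definition acyclic E : bool :=
  [forall k : 'I_#|V|.+1, forall c : k.-tuple V,
     (2 < k) ==> ~~ ucycleb (adj E) c].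

Definition forest E : bool := simple_graph E && acyclic E.

Definition num_components E : nat := n_comp (adj E) predT.

Lemma acyclicP E :
  reflect (forall c : seq V, ucycle (adj E) c -> size c <= 2) (acyclic E).
Proof.
apply: (iffP forallP) => [H c cP | H k].
  case: leqP => // c2; have /andP[_ uc] := cP.
  have ck : size c < #|V|.+1 by rewrite ltnS -(card_uniqP uc) max_card.
  have /forallP/(_ (in_tuple c)) := H (Ordinal ck).
  by rewrite /= c2 /= => /negP[].
apply/forallP => c; apply/implyP => k2; apply/negP => /H.
by rewrite size_tuple leqNgt k2.
Qed.

End Graphs.

(* Vertex i of [n] = {1, ..., n} is the ordinal of value i - 1, so that the
   vertices 1, ..., t are the ordinals of value less than t. *)
Definition forests_nt (n t : nat) : {set {set {set 'I_n}}} :=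
  [set E | [&& forest E, num_components E == t &
     [forall i : 'I_n, forall j : 'I_n,
        [&& i < t, j < t & i != j] ==> ~~ connect (adj E) i j]]].

Definition degree_sequence (n : nat) (E : {set {set 'I_n}}) :
  {ffun 'I_n -> nat} := [ffun v => degree E v].

(* A discrete distribution on a finite type is represented by its probability
   mass function; independence is the product of mass functions. *)
Section Distributions.

Local Open Scope ring_scope.

Definition uniform (T : finType) (A : {set T}) : T -> rat :=
  fun x => if x \in A then (#|A|%:R)^-1 else 0.

Definition iid (m : nat) (T : finType) (p : T -> rat) :
  {ffun 'I_m -> T} -> rat := fun f => \prod_(i < m) p (f i).

Definition indep_pair (T U : finType) (p : T -> rat) (q : U -> rat) :
  T * U -> rat := fun z => p z.1 * q z.2.

(* The mass function of the random variable X when its argument has mass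
   function p. *)
Definition law (T : finType) (S : eqType) (p : T -> rat) (X : T -> S) :
  S -> rat := fun s => \sum_(x | X x == s) p x.

Definition same_distribution (S : eqType) (p q : S -> rat) : Prop :=
  forall s, p s = q s.

End Distributions.

Definition load (m n : nat) (b : {ffun 'I_m -> 'I_n}) (j : 'I_n) : nat :=
  #|[set i | b i == j]|.

Definition balls_in_bins (n t : nat) :
  {ffun 'I_(n - t - 1) -> 'I_n} * 'I_t -> rat :=
  indep_pair (iid (uniform [set: 'I_n])) (uniform [set: 'I_t]).

Definition shifted_loads (n t : nat)
    (z : {ffun 'I_(n - t - 1) -> 'I_n} * 'I_t) : {ffun 'I_n -> nat} :=
  [ffun j : 'I_n =>
     if j < t then load z.1 j + (z.2 == j :> nat) else load z.1 j + 1].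

(* Main.v *)
(* Call the vertices 1, ..., t roots: a forest of the class is one in which
   every vertex is connected to exactly one root. A code is a word with one
   letter per non-root and with a root as last letter; listing the bins of the
   balls and then R gives a uniform code. The degree of a vertex in a code is
   its number of occurrences, plus 1 for non-roots. A non-root v has degree 1 in
   a forest if and only if the forest arises from one on the other vertices by
   joining v to some u, and it has degree 1 in a code if and only if the code is
   u :: c with u != v and c a code for the other vertices. Both operations raise
   the degrees of u and v by 1, so by induction the forests and the codes in
   which v has degree 1 have the same degree distribution. Nothing else remains:
   as soon as there is a non-root, every forest and every code has one of
   degree 1. *)

Require Import Defs.
From mathcomp Require Import all_boot all_order all_algebra.
From mathcomp Require Import zify.

Set Implicit Arguments.
Unset Strict Implicit.
Unset Printing Implicit Defensive.

Section Equidistribution.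

Variable T : eqType.
Implicit Types X Y : finType.

Definition equidistributed X Y (A : {set X}) (B : {set Y})
    (f : X -> T) (g : Y -> T) : Prop :=
  forall t, #|[set x in A | f x == t]| = #|[set y in B | g y == t]|.

Lemma count_image X (A : {pred X}) (f : X -> T) (P : pred T) :
  count P [seq f x | x in A] = #|[set x in A | P (f x)]|.
Proof.
rewrite count_map -size_filter cardE /enum_mem -filter_predI; congr size.
by apply: eq_filter => x; rewrite !inE /= andbC.
Qed.

Lemma equidistributed_card_pred X Y (A : {set X}) (B : {set Y}) f g
    (P : pred T) :
  equidistributed A B f g ->
  #|[set x in A | P (f x)]| = #|[set y in B | P (g y)]|.
Proof.
move=> eqAB; rewrite -!count_image; apply/permP/allP => t _.
by rewrite /= !count_image; apply/eqP/eqAB.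
Qed.

Lemma equidistributed_set1 X Y (x : X) (y : Y) f g :
  f x = g y -> equidistributed [set x] [set y] f g.
Proof.
move=> eq_fg t; rewrite -!(count_image _ _ (pred1 t)) /image_mem !enum_set1 /=.
by rewrite eq_fg.
Qed.

Lemma equidistributed_imset X Y (A : {set X}) (h : X -> Y) f g :
    {in A &, injective h} -> {in A, forall x, g (h x) = f x} ->
  equidistributed A (h @: A) f g.
Proof.
move=> h_inj gh t; rewrite -!sum1dep_card !big_mkcondr big_imset //=.
by apply: eq_bigr => x xA; rewrite gh.
Qed.

Lemma equidistributed_cover (I : finType) (J : {set I}) (P : I -> pred T)
    X Y (A : {set X}) (B : {set Y}) f g :
  {in A, forall x, exists2 i, i \in J & P i (f x)} ->
  {in B, forall y, exists2 i, i \in J & P i (g y)} ->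
  {in J, forall i, equidistributed [set x in A | P i (f x)]
                                   [set y in B | P i (g y)] f g} ->
  equidistributed A B f g.
Proof.
move=> coverA coverB eqAB t.
have [/exists_inP[i iJ Pt]|noP] := boolP [exists i in J, P i t].
  have fiberE (Z : finType) (C : {set Z}) (h : Z -> T) :
      [set z in C | h z == t] = [set z in [set z in C | P i (h z)] | h z == t].
    apply/setP => z; rewrite !inE.
    by have [->|] := eqVneq (h z) t; rewrite ?Pt ?andbT ?andbF.
  by rewrite (fiberE _ A) (fiberE _ B); apply: eqAB.
have fiber0 (Z : finType) (C : {set Z}) (h : Z -> T) :
    {in C, forall z, exists2 i, i \in J & P i (h z)} ->
    [set z in C | h z == t] = set0.
  move=> coverC; apply/setP => z; rewrite !inE; apply/andP => -[zC /eqP hz].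
  by case/exists_inP: noP; rewrite -hz; apply: coverC.
by rewrite !fiber0 // !cards0.
Qed.

Lemma card_imset2_fiber (I X Y : finType) (J : {set I}) (A : {set X})
    (h : I -> X -> Y) (f : X -> T) (F : Y -> T) (k : I -> T -> T) t :
  {in setX J A &, injective (uncurry h)} ->
  {in J & A, forall i x, F (h i x) = k i (f x)} ->
  #|[set y in h @2: (J, A) | F y == t]| =
  \sum_(i in J) #|[set x in A | k i (f x) == t]|.
Proof.
move=> h_inj Fh; rewrite curry_imset2X -sum1dep_card big_mkcondr big_imset //=.
under [RHS]eq_bigr => i _ do rewrite -sum1dep_card big_mkcondr /=.
rewrite pair_big; apply: eq_big => -[i x]; rewrite in_setX //=.
by case/andP=> iJ xA; rewrite Fh.
Qed.

Lemma equidistributed_imset2 (I X Y X' Y' : finType) (J : {set I})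
    (A : {set X}) (B : {set Y}) (f : X -> T) (g : Y -> T)
    (h : I -> X -> X') (h' : I -> Y -> Y') (F : X' -> T) (G : Y' -> T)
    (k : I -> T -> T) :
  {in setX J A &, injective (uncurry h)} ->
  {in setX J B &, injective (uncurry h')} ->
  {in J & A, forall i x, F (h i x) = k i (f x)} ->
  {in J & B, forall i y, G (h' i y) = k i (g y)} ->
  equidistributed A B f g ->
  equidistributed (h @2: (J, A)) (h' @2: (J, B)) F G.
Proof.
move=> h_inj h'_inj Fh Gh' eqAB t.
rewrite (card_imset2_fiber _ h_inj Fh) (card_imset2_fiber _ h'_inj Gh').
apply: eq_bigr => i _.
exact: equidistributed_card_pred (fun d => k i d == t) eqAB.
Qed.

Lemma law_uniform X (A : {set X}) (f : X -> T) t :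
  (law (uniform A) f t = #|[set x in A | f x == t]|%:R / #|A|%:R)%R.
Proof.
rewrite /law /uniform -big_mkcondr /= GRing.sumr_const GRing.mulr_natl.
by congr (_ *+ _)%R; apply: eq_card => x; rewrite !inE unfold_in /= andbC.
Qed.

Lemma same_distribution_law_uniform X Y (A : {set X}) (B : {set Y}) f g :
  equidistributed A B f g ->
  same_distribution (law (uniform A) f) (law (uniform B) g).
Proof.
move=> eqAB t; rewrite !law_uniform eqAB.
have setIdT Z (C : {set Z}) : [set z in C | predT z] = C.
  by apply/setP => z; rewrite inE andbT.
by have := equidistributed_card_pred predT eqAB; rewrite !setIdT => ->.
Qed.

End Equidistribution.

Section Transversals.

Variables (T : finType) (e : rel T) (A : {set T}).

Definition connected_to x := [set a in A | connect e a x].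

Lemma card1_connected_to_eq a b :
    #|connected_to b| == 1 -> a \in A -> b \in A -> connect e a b -> a = b.
Proof.
move=> one_b aA bA ab; apply: (card_le1_eqP (eq_leq (eqP one_b)));
  by rewrite inE ?aA ?bA ?connect0.
Qed.

Hypothesis sym_e : connect_sym e.

Lemma n_comp_eq_card :
    {in A &, forall a b, connect e a b -> a = b} ->
  (n_comp e predT == #|A|) = [forall x, exists a in A, connect e a x].
Proof.
move=> sep_A; have -> : n_comp e predT = #|roots e|.
  by apply: eq_card => x; rewrite !inE andbT.
have <- : #|fingraph.root e @: A| = #|A|.
  by apply: card_in_imset => a b aA bA /(fingraph.rootP sym_e); apply: sep_A.
have sub_roots : fingraph.root e @: A \subset roots e.
  by apply/subsetP => _ /imsetP[a _ ->]; apply: roots_root.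
rewrite eq_sym (subset_leqif_card sub_roots).
apply/subsetP/'forall_exists_inP => [roots_sub x|span x /eqP root_x].
  have /imsetP[a aA root_a] := roots_sub _ (roots_root sym_e x).
  by exists a => //; apply/(fingraph.rootP sym_e).
have [a aA /(fingraph.rootP sym_e) root_a] := span x.
by apply/imsetP; exists a; rewrite // root_a.
Qed.

Lemma n_comp_transversal :
  (forall x, #|connected_to x| == 1) <->
  n_comp e predT = #|A| /\ {in A &, forall a b, connect e a b -> a = b}.
Proof.
split=> [one_x|[/eqP + sep_A]].
  have sep_A : {in A &, forall a b, connect e a b -> a = b}.
    by move=> a b; apply: card1_connected_to_eq.
  split=> //; apply/eqP; rewrite n_comp_eq_card //.
  apply/'forall_exists_inP => x; have /cards1P[a to_x] := one_x x.
  have : a \in connected_to x by rewrite to_x set11.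
  by rewrite inE => /andP[]; exists a.
rewrite n_comp_eq_card // => /'forall_exists_inP span x.
have [a aA ax] := span x; apply/cards1P; exists a; apply/setP => b.
rewrite !inE; apply/andP/eqP => [[bA bx]|-> //]; apply: sep_A => //.
by apply: connect_trans bx _; rewrite sym_e.
Qed.

End Transversals.

Section Adjacency.

Variable V : finType.
Implicit Types (E : {set {set V}}) (x y u v : V).

Lemma adj_sym E : symmetric (adj E).
Proof. by move=> x y; rewrite /adj setUC. Qed.

Lemma adj_subset E E' : E' \subset E -> subrel (adj E') (adj E).
Proof. by move=> sE x y; apply: (subsetP sE). Qed.

Lemma adj_neq E x y : simple_graph E -> adj E x y -> x != y.
Proof.
by move=> /forall_inP simple_E /simple_E; rewrite cards2; case: (x != y).
Qed.

Lemma adj_cover E x y : adj E x y -> (x \in cover E) && (y \in cover E).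
Proof.
move=> Exy; apply/andP; split; apply/bigcupP; exists [set x; y] => //;
  by rewrite !inE eqxx ?orbT.
Qed.

Lemma connect_adj_sym E : connect_sym (adj E).
Proof. exact/sym_connect_sym/adj_sym. Qed.

Lemma simple_graph_subset E E' :
  E' \subset E -> simple_graph E -> simple_graph E'.
Proof.
move=> /subsetP sE /forall_inP simple_E.
by apply/forall_inP => e /sE; apply: simple_E.
Qed.

Lemma acyclic_subset E E' : E' \subset E -> acyclic E -> acyclic E'.
Proof.
move=> sE /acyclicP acyclic_E; apply/acyclicP => c /andP[cycle_c uniq_c].
apply: acyclic_E.
by rewrite /ucycle uniq_c andbT (sub_cycle (adj_subset sE)).
Qed.

Lemma forest_subset E E' : E' \subset E -> forest E -> forest E'.
Proof.
move=> sE /andP[simple_E acyclic_E]; apply/andP; split.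
  exact: simple_graph_subset simple_E.
exact: acyclic_subset acyclic_E.
Qed.

Definition add_edge v u E : {set {set V}} := [set v; u] |: E.

End Adjacency.

Section AddLeaf.

Variables (V : finType) (E : {set {set V}}) (u v : V).
Implicit Types x y : V.
Hypotheses (vE : v \notin cover E) (uv : u != v).

Local Notation E' := (add_edge v u E).

Lemma adj_isolated x : adj E v x = false.
Proof. by apply: contraNF vE => /adj_cover/andP[]. Qed.

Lemma degree_isolated : degree E v = 0.
Proof. by apply: eq_card0 => x; rewrite inE adj_isolated. Qed.

Lemma adj_add_leaf x : adj E' v x = (x == u).
Proof.
rewrite /adj in_setU1 [_ \in E]adj_isolated orbF.
apply/eqP/eqP => [eq_vx|-> //].
have : u \in [set v; x] by rewrite eq_vx !inE eqxx orbT.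
by rewrite !inE (negPf uv) => /eqP.
Qed.

Lemma adj_add_leaf_neq x y : x != v -> y != v -> adj E' x y = adj E x y.
Proof.
move=> xv yv; rewrite /adj in_setU1; case: eqP => //= eq_xy.
have : v \in [set x; y] by rewrite eq_xy !inE eqxx.
by rewrite !inE ![v == _]eq_sym (negPf xv) (negPf yv).
Qed.

Lemma degree_add_leaf x : degree E' x = degree E x + ((x == u) + (x == v)).
Proof.
have [->|xv] := eqVneq x v.
  rewrite degree_isolated eq_sym (negPf uv); apply/eqP/cards1P.
  by exists u; apply/setP => y; rewrite !inE adj_add_leaf.
rewrite addn0 /degree (cardsD1 v) inE adj_sym adj_add_leaf addnC.
congr (_ + _); apply: eq_card => y; rewrite !inE.
have [->|yv] /= := eqVneq y v; first by rewrite adj_sym adj_isolated.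
by rewrite adj_add_leaf_neq.
Qed.

Lemma acyclic_add_leaf : acyclic E -> acyclic E'.
Proof.
move=> /acyclicP acyclic_E; apply/acyclicP => c /andP[cycle_c uniq_c].
have [vc|vc] := boolP (v \in c); last first.
  have c_neq : all (predC1 v) c.
    by apply/allP => x xc /=; apply: contraNneq vc => <-.
  apply: acyclic_E; rewrite /ucycle uniq_c andbT.
  by rewrite -(eq_in_cycle adj_add_leaf_neq c_neq).
have [i p eq_c] := rot_to vc; rewrite -(size_rot i).
move: cycle_c uniq_c; rewrite -(rot_cycle i) -(rot_uniq i) {}eq_c.
case: p => [|y p] //; case/lastP: p => [|p z] //.
rewrite /= rcons_path last_rcons (adj_sym _ z) !adj_add_leaf.
by case/andP=> /eqP-> /andP[_ /eqP->]; rewrite mem_rcons inE eqxx /= andbF.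
Qed.

Lemma forest_add_leaf : forest E' = forest E.
Proof.
apply/idP/idP => [|/andP[/forall_inP simple_E acyclic_E]].
  exact/forest_subset/subsetUr.
rewrite /forest acyclic_add_leaf // andbT; apply/forall_inP => e.
by case/setU1P=> [->|/simple_E //]; rewrite cards2 [v == u]eq_sym uv.
Qed.

(* Contracting the new edge maps every walk to a walk avoiding the leaf. *)
Lemma connect_add_leaf x y :
  connect (adj E') x y =
  connect (adj E) (if x == v then u else x) (if y == v then u else y).
Proof.
pose contract z := if z == v then u else z; rewrite -!/(contract _).
have to_contract z : connect (adj E') z (contract z).
  rewrite /contract; case: eqP => // ->.
  by apply: connect1; rewrite adj_add_leaf.
apply/idP/idP => [/connectP[p]|contr_xy].
  elim: p x => [x _ -> //|z p IH x] /= /andP[xz zp] /(IH z zp).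
  apply: connect_trans; rewrite /contract.
  have [xv|xv] := eqVneq x v.
    by move: xz; rewrite xv adj_add_leaf => /eqP->; rewrite (negPf uv).
  have [zv|zv] := eqVneq z v.
    by move: xz; rewrite zv adj_sym adj_add_leaf => /eqP->.
  by apply: connect1; rewrite -adj_add_leaf_neq.
apply: connect_trans (to_contract x) _.
rewrite connect_adj_sym; apply: connect_trans (to_contract y) _.
rewrite connect_adj_sym; apply: connect_sub contr_xy => a b ab.
exact/connect1/(adj_subset _ ab)/subsetUr.
Qed.

End AddLeaf.

Section Leaves.

Variable V : finType.
Implicit Types (E : {set {set V}}) (x y z v : V) (p : seq V).

Lemma leaf_add_edge E v :
    simple_graph E -> degree E v = 1 ->
  exists u E', [/\ u != v, v \notin cover E' & E = add_edge v u E'].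
Proof.
move=> simple_E /eqP/cards1P[u /setP nbrs]; exists u, (E :\ [set v; u]).
have adj_v y : adj E v y = (y == u) by have := nbrs y; rewrite !inE.
split; first by rewrite eq_sym (adj_neq simple_E) ?adj_v.
  apply/bigcupP => -[e /setD1P[e_vu eE] ve]; case/eqP: e_vu.
  have /cards2P[a [b [_ eab]]] := forall_inP simple_E e eE.
  move: ve eE; rewrite {}eab => /set2P[<- | <-].
    by rewrite -/(adj E v b) adj_v => /eqP->.
  by rewrite setUC -/(adj E v a) adj_v => /eqP->.
by rewrite /add_edge setD1K // -/(adj E v u) adj_v.
Qed.

Lemma acyclic_path_no_chord E x y p z :
  acyclic E -> path (adj E) x (y :: p) -> uniq [:: x, y & p] ->
  adj E x z -> z \notin p.
Proof.
move=> /acyclicP acyclic_E path_p uniq_p xz; apply/negP => zp.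
case/splitPr: zp path_p uniq_p => p1 p2; rewrite -cat_rcons -cat_cons.
move=> path_p uniq_p.
suff /acyclic_E : ucycle (adj E) [:: x, y & rcons p1 z].
  by rewrite /= size_rcons.
move: uniq_p path_p; rewrite -cat_cons cat_uniq cat_path /ucycle.
case/andP=> -> _ /andP[path_rcons _].
by rewrite andbT /cycle rcons_path path_rcons /= last_rcons adj_sym.
Qed.

Lemma forest_path_extend E x p :
  forest E -> p != [::] ->
  path (adj E) x p -> uniq (x :: p) -> degree E x != 1 ->
  exists z, path (adj E) z (x :: p) && uniq (z :: x :: p).
Proof.
case/andP=> simple_E acyclic_E; case: p => // y p _ path_p uniq_p deg_x.
have /andP[xy _] := path_p.
have [z /andP[xz zy]] : exists z, adj E x z && (z != y).
  have : 0 < #|[set z | adj E x z] :\ y|.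
    by move: deg_x; rewrite /degree (cardsD1 y) inE xy; case: #|_|.
  by case/card_gt0P=> z; rewrite !inE andbC; exists z.
exists z; apply/andP; split; first by rewrite /= adj_sym xz.
rewrite cons_uniq uniq_p andbT !inE !negb_or zy.
rewrite [z == x]eq_sym (adj_neq simple_E xz) /=.
exact: acyclic_path_no_chord acyclic_E path_p uniq_p xz.
Qed.

(* Extend the path backwards until it starts in a leaf. *)
Lemma forest_path_leaf E x p :
  forest E -> p != [::] -> path (adj E) x p -> uniq (x :: p) ->
  exists w, [/\ degree E w = 1, w != last x p & connect (adj E) w (last x p)].
Proof.
move=> forest_E; have [k] := ubnP (#|V| - size p).
elim: k x p => // k IHk x p size_p p_neq0 path_p uniq_p.
have [deg_x|deg_x] := eqVneq (degree E x) 1.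
  exists x; split=> //; last by apply/connectP; exists p.
  apply: contraTneq uniq_p => ->; case: p p_neq0 {size_p path_p} => // y p _.
  by rewrite /= mem_last.
have [z /andP[path_zp uniq_zp]] :=
  forest_path_extend forest_E p_neq0 path_p uniq_p deg_x.
have [|w] := IHk z (x :: p) _ isT path_zp uniq_zp; last by exists w.
have : size (z :: x :: p) <= #|V| by rewrite -(card_uniqP uniq_zp) max_card.
by move: size_p => /=; lia.
Qed.

End Leaves.

Section RootedForests.

Variable V : finType.
Implicit Types (E : {set {set V}}) (A S : {set V}) (a b u v x : V).

Definition rooted_forest A S E :=
  [&& forest E, cover E \subset S
    & [forall x in S, #|connected_to (adj E) A x| == 1]].

Definition rooted_forests A S := [set E | rooted_forest A S E].

Definition degrees E : {ffun V -> nat} := [ffun x => degree E x].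

Definition add_ends v u (d : {ffun V -> nat}) : {ffun V -> nat} :=
  [ffun x => d x + ((x == u) + (x == v))].

Lemma rooted_forest_leaf A S E :
    A \proper S -> rooted_forest A S E ->
  exists2 v, v \in S :\: A & degree E v = 1.
Proof.
case/properP=> /subsetP sAS [x xS xA] /and3P[forest_E cover_E].
move=> /forall_inP one_root; have /cards1P[a to_x] := one_root x xS.
have : a \in connected_to (adj E) A x by rewrite to_x set11.
rewrite inE connect_adj_sym => /andP[aA /connectP[p path_p def_a]].
case/shortenP: path_p def_a => q path_q uniq_q _ def_a.
have q_neq0 : q != [::].
  by apply: contraNneq xA => q_neq0; move: def_a; rewrite q_neq0 /= => <-.
have [v [deg_v va conn_va]] := forest_path_leaf forest_E q_neq0 path_q uniq_q.
rewrite -def_a in va conn_va.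
exists v; rewrite // inE; apply/andP; split.
  apply: contra va => vA; apply/eqP.
  exact: card1_connected_to_eq (one_root a (sAS a aA)) vA aA conn_va.
have /card_gt0P[y] : 0 < degree E v by rewrite deg_v.
by rewrite inE => /adj_cover/andP[/(subsetP cover_E)].
Qed.

Lemma rooted_forests_roots A : rooted_forests A A = [set set0].
Proof.
apply/setP => E; rewrite !inE; apply/and3P/eqP => [|->].
  case=> /andP[/forall_inP simple_E _] /subsetP cover_E /forall_inP one_root.
  apply/setP => e; rewrite inE; apply/negP => eE.
  have /cards2P[a [b [ab eab]]] := simple_E e eE.
  have adj_ab : adj E a b by rewrite /adj -eab.
  have /andP[/cover_E aA /cover_E bA] := adj_cover adj_ab.
  case/eqP: ab.
  exact: card1_connected_to_eq (one_root b bA) aA bA (connect1 adj_ab).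
split; [|by rewrite /cover big_set0 sub0set|].
  apply/andP; split; first by apply/forall_inP => e; rewrite inE.
  by apply/acyclicP => -[|x [|y c]] //=; case/andP=> /=; rewrite /adj inE.
apply/forall_inP => x xA; apply/cards1P; exists x; apply/setP => a.
rewrite !inE; apply/andP/eqP => [[_ /connectP[[|y p]]]|->] //=.
by rewrite /adj inE.
Qed.

Lemma degrees_set0 : degrees set0 = [ffun=> 0].
Proof.
by apply/ffunP => x; rewrite !ffunE degree_isolated // /cover big_set0 inE.
Qed.

Lemma rooted_forest_add_leaf A S E u v :
    v \notin cover E -> u != v -> v \in S :\: A -> u \in S ->
  rooted_forest A S (add_edge v u E) = rooted_forest A (S :\ v) E.
Proof.
move=> vE uv /setDP[vS vA] uS; rewrite /rooted_forest forest_add_leaf //.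
congr [&& _, _ & _].
  rewrite /cover bigcup_setU big_set1 !subUset !sub1set vS uS /=.
  by rewrite subsetD1 vE andbT.
have connected_toE x : connected_to (adj (add_edge v u E)) A x =
    connected_to (adj E) A (if x == v then u else x).
  apply/setP => a; rewrite !inE connect_add_leaf //; apply: andb_id2l => aA.
  by rewrite ifN //; apply: contraNneq vA => <-.
apply/forall_inP/forall_inP => one_root x.
  by case/setD1P=> xv /one_root; rewrite connected_toE (negPf xv).
rewrite connected_toE => xS; apply: one_root.
by case: eqVneq => xv; rewrite !inE ?uv ?xv.
Qed.

Section DeleteLeaf.

Variables (A S : {set V}) (v : V).
Hypothesis vSA : v \in S :\: A.

Local Notation smaller_forests := (rooted_forests A (S :\ v)).

Lemma rooted_forest_notin_cover E : E \in smaller_forests -> v \notin cover E.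
Proof.
rewrite inE => /and3P[_ /subsetP cover_E _].
by apply/negP => /cover_E; rewrite !inE eqxx.
Qed.

Lemma rooted_forests_leaf :
  [set E in rooted_forests A S | degrees E v == 1] =
  add_edge v @2: (S :\ v, smaller_forests).
Proof.
apply/setP => E; rewrite 2!inE ffunE; apply/andP/imset2P => [[EF /eqP deg_v]|].
  have /and3P[/andP[simple_E _] /subsetP cover_E _] := EF.
  have [u [E' [uv vE' eqE]]] := leaf_add_edge simple_E deg_v.
  have uS : u \in S.
    apply: cover_E; rewrite eqE.
    by apply/bigcupP; exists [set v; u]; rewrite !inE ?eqxx ?orbT.
  exists u E'; rewrite // !inE ?uv //.
  by rewrite -(rooted_forest_add_leaf vE' uv vSA uS) -eqE.
case=> u E' /setD1P[uv uS] EF' ->; have vE' := rooted_forest_notin_cover EF'.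
rewrite rooted_forest_add_leaf //; split; first by rewrite inE in EF'.
rewrite degree_add_leaf // degree_isolated // eqxx.
by rewrite [v == u]eq_sym (negPf uv).
Qed.

Lemma add_edge_inj :
  {in setX (S :\ v) smaller_forests &, injective (uncurry (add_edge v))}.
Proof.
move=> [u E] [w E'] /setXP[/= /setD1P[uv _] EF] /setXP[/= /setD1P[wv _] EF'].
have vE := rooted_forest_notin_cover EF.
have vE' := rooted_forest_notin_cover EF'.
move=> eq_add; have eq_uw : u = w.
  by apply/eqP; rewrite -(adj_add_leaf vE' wv) -eq_add adj_add_leaf.
have vw_notin D : v \notin cover D -> [set v; w] \notin D.
  by apply: contra => vw; apply/bigcupP; exists [set v; w]; rewrite ?set21.
move: eq_add; rewrite eq_uw /add_edge => eq_add.
by rewrite -(setU1K (vw_notin E vE)) eq_add setU1K ?vw_notin.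
Qed.

Lemma degrees_add_edge :
  {in S :\ v & smaller_forests, forall u E,
    degrees (add_edge v u E) = add_ends v u (degrees E)}.
Proof.
move=> u E /setD1P[uv _] /rooted_forest_notin_cover vE.
by apply/ffunP => x; rewrite !ffunE degree_add_leaf.
Qed.

End DeleteLeaf.

End RootedForests.

Section PruferCodes.

Variable V : finType.
Implicit Types (A S : {set V}) (c : seq V) (u v x : V).

(* The empty word is a code so that the forest without edges has one when all
   vertices are roots. *)
Definition prufer_code A S c :=
  all (mem S) c && (if c is x :: c' then last x c' \in A else true).

Definition prufer_codes m A S := [set c : m.-tuple V | prufer_code A S c].

Definition prufer_degrees A S c : {ffun V -> nat} :=
  [ffun x => count_mem x c + (x \in S :\: A)].

Lemma prufer_code_rcons A S c r :
  prufer_code A S (rcons c r) = all (mem S) (rcons c r) && (r \in A).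
Proof. by case: c => [|x c] //=; rewrite /prufer_code /= last_rcons. Qed.

Lemma prufer_code_leaf A S c :
    prufer_code A S c -> size c = #|S :\: A| -> A \proper S ->
  exists2 v, v \in S :\: A & prufer_degrees A S c v = 1.
Proof.
case/lastP: c => [_ /esym/eqP|c r].
  by rewrite cards_eq0 setD_eq0 properE => -> /andP[].
rewrite prufer_code_rcons size_rcons => /andP[_ rA] size_c _.
have /subsetPn[v vSA vc] : ~~ (S :\: A \subset c).
  apply/negP => /subset_leq_card; rewrite -size_c.
  by move/leq_trans/(_ (card_size c)); rewrite ltnn.
exists v => //; rewrite ffunE vSA (count_memPn _) // mem_rcons inE negb_or vc.
by rewrite andbT; case/setDP: vSA => _; apply: contraNneq => ->.
Qed.

Section DeleteLeaf.

Variables (A S : {set V}) (v : V).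
Hypothesis vSA : v \in S :\: A.

Lemma prufer_code_cons u c :
    #|S :\: A| = (size c).+1 ->
  prufer_code A S (u :: c) && (v \notin u :: c) =
  (u \in S :\ v) && prufer_code A (S :\ v) c.
Proof.
have all_rem : all (mem (S :\ v)) c = all (mem S) c && (v \notin c).
  elim: c => //= x c ->; rewrite !inE negb_or [v == x]eq_sym.
  by rewrite -!andbA; do !bool_congr.
move=> card_SA; rewrite /prufer_code all_rem !inE negb_or [v == u]eq_sym /=.
case: c card_SA {all_rem} => [/eqP/cards1P[w SA]|x c _] /=; last first.
  by rewrite -!andbA; do !bool_congr.
have /set1P v_eq : v \in [set w] by rewrite -SA.
have /setP/(_ u) := SA; rewrite !inE -v_eq.
by case: (u \in A) (u \in S) (u == v) => [] [] [].
Qed.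

Lemma prufer_codes_leaf m :
    #|S :\: A| = m.+1 ->
  [set c in prufer_codes m.+1 A S | prufer_degrees A S c v == 1] =
  @cons_tuple m V @2: (S :\ v, prufer_codes m A (S :\ v)).
Proof.
move=> card_SA; apply/setP => c; case/tupleP: c => u c.
have card_SA_c : #|S :\: A| = (size c).+1 by rewrite size_tuple.
rewrite 2!inE ffunE vSA addn1 eqSS -leqn0 leqNgt -has_count has_pred1.
rewrite (prufer_code_cons _ card_SA_c); apply/andP/imset2P => [[uS cP]|].
  by exists u c; rewrite // inE.
by case=> w d wS; rewrite inE => dP [-> /val_inj->].
Qed.

Lemma prufer_degrees_cons u c :
  prufer_degrees A S (u :: c) = add_ends v u (prufer_degrees A (S :\ v) c).
Proof.
apply/ffunP => x; rewrite !ffunE /= [u == x]eq_sym.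
suff -> : (x \in S :\: A) = (x == v) + (x \in S :\ v :\: A) :> nat by lia.
by rewrite !inE; case: eqVneq => [->|_] //=; case/setDP: vSA => -> /negPf->.
Qed.

End DeleteLeaf.

Lemma prufer_codes0 A : prufer_codes 0 A A = [set [tuple]].
Proof. by apply/setP => c; rewrite tuple0 !inE. Qed.

Lemma prufer_degrees_nil A : prufer_degrees A A [::] = [ffun=> 0].
Proof. by apply/ffunP => x; rewrite !ffunE setDv inE. Qed.

End PruferCodes.

Lemma equidistributed_rooted_forests_prufer_codes (V : finType) m
    (A S : {set V}) :
    A \subset S -> #|S :\: A| = m ->
  equidistributed (rooted_forests A S) (prufer_codes m A S)
    (@degrees V) (prufer_degrees A S).
Proof.
elim: m S => [|m IHm] S sAS card_SA.
  have -> : S = A.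
    by apply/eqP; rewrite eqEsubset sAS andbT -setD_eq0 -cards_eq0 card_SA.
  rewrite rooted_forests_roots prufer_codes0; apply: equidistributed_set1.
  by rewrite degrees_set0 prufer_degrees_nil.
have pAS : A \proper S.
  by rewrite properE sAS -setD_eq0 -cards_eq0 card_SA.
apply: (equidistributed_cover (J := S :\: A)
  (P := fun v (d : {ffun V -> nat}) => d v == 1)).
- move=> E; rewrite inE => /(rooted_forest_leaf pAS)[v vSA deg_v].
  by exists v; rewrite // ffunE deg_v.
- move=> c; rewrite inE => code_c.
  have [|v vSA deg_v] := prufer_code_leaf code_c _ pAS.
    by rewrite size_tuple.
  by exists v; rewrite // deg_v.
move=> v vSA; rewrite rooted_forests_leaf // prufer_codes_leaf //.
apply: (equidistributed_imset2 (k := add_ends v)) (IHm (S :\ v) _ _).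
- exact: add_edge_inj.
- by move=> [u c] [w d] _ _ [-> /val_inj->].
- exact: degrees_add_edge.
- by move=> u c _ _; apply: prufer_degrees_cons.
- by rewrite subsetD1 sAS; case/setDP: vSA.
- have -> : S :\ v :\: A = (S :\: A) :\ v by rewrite !setDDl setUC.
  by move: card_SA; rewrite (cardsD1 v) vSA => -[].
Qed.

Lemma load_count m n (b : {ffun 'I_m -> 'I_n}) j :
  load b j = count_mem j [seq b i | i <- enum 'I_m].
Proof.
by rewrite (count_image _ _ (pred1 j)); apply: eq_card => i; rewrite !inE.
Qed.

Section ForestsNT.

Variables (n t : nat) (t_le : t <= n).

Definition initial_vertices : {set 'I_n} := [set i : 'I_n | i < t].

Lemma card_initial_vertices : #|initial_vertices| = t.
Proof.
by rewrite -sum1dep_card -(big_ord_widen n (fun=> 1) t_le) sum1_card card_ord.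
Qed.

Lemma forests_ntE : forests_nt n t = rooted_forests initial_vertices setT.
Proof.
apply/setP => E; rewrite !inE /rooted_forest subsetT; congr (_ && _).
have [] := n_comp_transversal initial_vertices (connect_adj_sym E).
rewrite card_initial_vertices => to_transversal from_transversal.
apply/andP/forall_inP => [[/eqP nt /'forall_forallP sep] x _|one_root].
  apply: from_transversal; split=> // i j; rewrite !inE => it jt ij.
  by apply: contraTeq ij => ij; have /implyP-> := sep i j; rewrite ?it ?jt.
have [|nt sep] := to_transversal; first by move=> x; apply: one_root.
split; first exact/eqP; apply/'forall_forallP => i j.
apply/implyP => /and3P[it jt]; apply: contra => ij.
by apply/eqP/sep; rewrite ?inE.
Qed.

Definition balls_code m (z : {ffun 'I_m -> 'I_n} * 'I_t) : m.+1.-tuple 'I_n :=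
  rcons_tuple [tuple z.1 i | i < m] (widen_ord t_le z.2).

Lemma balls_code_inj m : injective (@balls_code m).
Proof.
move=> [b r] [b' r'] /(congr1 val) /rcons_inj[eq_b eq_r].
congr (_, _); last exact: val_inj.
by apply/ffunP => i; move/eq_in_map: eq_b; apply; rewrite mem_enum.
Qed.

Lemma prufer_codes_balls m :
  prufer_codes m.+1 initial_vertices setT = @balls_code m @: setT.
Proof.
apply/setP => c; rewrite inE; apply/idP/imsetP => [|[z _ ->]]; last first.
  rewrite prufer_code_rcons inE /= ltn_ord andbT.
  by apply/allP => x _; apply: in_setT.
case/tupleP: c => x c /andP[_]; rewrite inE => last_lt_t.
exists ([ffun i => tnth (belast_tuple x c) i], Ordinal last_lt_t) => //.
apply: val_inj; rewrite /= lastI; congr rcons; last exact: val_inj.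
rewrite -[LHS](map_tnth_enum (belast_tuple x c)).
by apply: eq_map => i; rewrite ffunE.
Qed.

Lemma prufer_degrees_balls (z : {ffun 'I_(n - t - 1) -> 'I_n} * 'I_t) :
  prufer_degrees initial_vertices setT (balls_code z) = shifted_loads z.
Proof.
apply/ffunP => j; rewrite !ffunE /= load_count -cats1 count_cat /= addn0.
rewrite !inE andbT -val_eqE /=; case: ltnP => [_|t_le_j].
  by rewrite addn0.
by rewrite ltn_eqF ?addn0 //; apply: leq_trans t_le_j.
Qed.

Lemma equidistributed_shifted_loads_prufer_codes :
  equidistributed setT (prufer_codes (n - t - 1).+1 initial_vertices setT)
    (@shifted_loads n t) (prufer_degrees initial_vertices setT).
Proof.
rewrite prufer_codes_balls; apply: equidistributed_imset => [|z _].
  by move=> z z' _ _; apply: balls_code_inj.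
exact: prufer_degrees_balls.
Qed.

End ForestsNT.

Lemma balls_in_bins_uniform n t :
  @balls_in_bins n t =1 uniform [set: {ffun 'I_(n - t - 1) -> 'I_n} * 'I_t].
Proof.
move=> z; rewrite /balls_in_bins /indep_pair /iid /uniform !inE.
under eq_bigr do rewrite inE.
rewrite GRing.prodr_const !cardsT card_prod card_ffun !card_ord.
by rewrite GRing.natrM GRing.natrX GRing.invfM GRing.exprVn.
Qed.

Theorem theorem6p2 (n t : nat) (t_gt0 : 0 < t) (t_le : t <= n - 1) :
  same_distribution
    (law (@balls_in_bins n t) (@shifted_loads n t))
    (law (uniform (forests_nt n t)) (@degree_sequence n)).
Proof.
have t_le_n : t <= n by lia.
move=> s; transitivity (law (uniform setT) (@shifted_loads n t) s).
  by apply: eq_bigr => z _; apply: balls_in_bins_uniform.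
apply: same_distribution_law_uniform s => s.
rewrite equidistributed_shifted_loads_prufer_codes // forests_ntE //.
apply/esym/equidistributed_rooted_forests_prufer_codes; first exact: subsetT.
have := cardsC (initial_vertices n t).
by rewrite setTD card_initial_vertices // card_ord; lia.
Qed.
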